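(* Let $G$ be a finite group, let $\mathcal{F}$ be an injective group cellular automaton on $G$, and let $\{(\mathcal{F}_1,G_1),\dots,(\mathcal{F}_k,G_k)\}=\mathtt{Decomposition}(\mathcal{F},G)$ be the collection of (necessarily injective) group cellular automata returned by the function $\mathtt{Decomposition}$ on input $(\mathcal{F},G)$. Then $\mathcal{F}$ is expansive if and only if, for every $i\in\{1,\dots,k\}$, the group cellular automaton $\mathcal{F}_i$ on $G_i$ is expansive.
   Context: For a finite group $G$, $G^{\mathbb{Z}}$ is a group under the componentwise operation, with the product topology of the discrete topologies on the factors; this topology is induced by the metric $d(c,c')=0$ if $c=c'$ and $d(c,c')=2^{-\min\{|j|:\ c_j\neq c'_j\}}$ otherwise. A group cellular automaton (GCA) on $G$ is a continuous group endomorphism $\mathcal{F}:G^{\mathbb{Z}}\to G^{\mathbb{Z}}$ commuting with the shift $\sigma$, $\sigma(c)_i=c_{i+1}$. An injective GCA is bijective and its inverse is again a GCA. An injective GCA $\mathcal{F}$ is expansive if there is $\epsilon>0$ such that for any two distinct $c,c'\in G^{\mathbb{Z}}$ there is $n\in\mathbb{Z}$ with $d(\mathcal{F}^n(c),\mathcal{F}^n(c'))>\epsilon$. A subgroup $H\le G$ is fully invariant if $\phi(H)\le H$ for every endomorphism $\phi$ of $G$; fully invariant subgroups are normal. A group $G$ is invariantly simple if its only fully invariant subgroups are the trivial subgroup and $G$. If $H\trianglelefteq G$ and $\mathcal{F}$ is a GCA on $G$ with $\mathcal{F}(H^{\mathbb{Z}})\subseteq H^{\mathbb{Z}}$, define the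 GCA $\overline{\mathcal{F}}_H:H^{\mathbb{Z}}\to H^{\mathbb{Z}}$ by $\overline{\mathcal{F}}_H(c)=\mathcal{F}(c)$ and the GCA $\widetilde{\mathcal{F}}_H:(G/H)^{\mathbb{Z}}\to (G/H)^{\mathbb{Z}}$ by $\widetilde{\mathcal{F}}_H([c])=[\mathcal{F}(c)]$, where $[c]=(\cdots[c_{-1}][c_0][c_1]\cdots)$ is the configuration of cosets. (If $H$ is fully invariant, $\mathcal{F}(H^{\mathbb{Z}})\subseteq H^{\mathbb{Z}}$ holds for every GCA $\mathcal{F}$ on $G$, because the local rule of a GCA is a pointwise product of endomorphisms of $G$.) The function $\mathtt{Decomposition}(\mathcal{F},G)$ is defined recursively: if $G$ is invariantly simple, return $\{(\mathcal{F},G)\}$; otherwise choose a non-trivial proper fully invariant subgroup $H$ of $G$ and return $\mathtt{Decomposition}(\widetilde{\mathcal{F}}_H,G/H)\cup\mathtt{Decomposition}(\overline{\mathcal{F}}_H,H)$. The choice of $H$ at each step is arbitrary. *)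

(* Defs.v *)
From HB Require Import structures.
From mathcomp Require Import all_boot all_order all_algebra all_fingroup.
From mathcomp Require Import all_classical all_reals all_analysis.

Set Implicit Arguments.
Unset Strict Implicit.
Unset Printing Implicit Defensive.

Import Order.TTheory GRing.Theory Num.Theory GroupScope.
Local Open Scope classical_set_scope.

Definition config (gT : finGroupType) : Type := int -> gT.

Definition mulc (gT : finGroupType) (c c' : config gT) : config gT :=
  fun i => (c i * c' i)%g.

Definition shiftc (gT : finGroupType) (c : config gT) : config gT :=
  fun i => c (i + 1)%R.

(* Continuity refers to the product of the discrete topologies. *)
Definition is_gca (gT : finGroupType) (F : config gT -> config gT) : Prop :=
  [/\ continuous (F : {ptws int -> discrete_topology gT} ->
                      {ptws int -> discrete_topology gT}),
      {morph F : c c' / mulc c c'}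
    & {morph F : c / shiftc c}].

Definition differ_at (gT : finGroupType) (c c' : config gT) : pred nat :=
  fun n => (c n%:Z != c' n%:Z)%R || (c (- n%:Z) != c' (- n%:Z))%R.

Lemma differ_atP (gT : finGroupType) (c c' : config gT) :
  c <> c' -> exists n, differ_at c c' n.
Proof.
move=> cc'; apply: contrapT => /forallNP same; apply: cc'; apply/funext => i.
have /negP := same `|i|%N; rewrite negb_or !negbK => /andP[/eqP ep /eqP en].
by case: i ep en => n //; rewrite NegzE abszN.
Qed.

(* [ex_minn (differ_atP h)] is the least |j| such that c_j <> c'_j. *)
Definition cdist (R : realType) (gT : finGroupType) (c c' : config gT) : R :=
  match pselect (c = c') with
  | left _ => 0%R
  | right h => (2 ^- ex_minn (differ_atP h))%R
  end.

(* For a bijective F this is the inverse of F; every injective GCA is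
   bijective. *)
Definition inv_gca (gT : finGroupType) (F : config gT -> config gT) :
    config gT -> config gT :=
  'pinv_(fun=> fun=> 1%g) setT F.

Definition iterz (gT : finGroupType) (F : config gT -> config gT) (n : int) :
    config gT -> config gT :=
  match n with
  | Posz k => iter k F
  | Negz k => iter k.+1 (inv_gca F)
  end.

(* Meaningful for injective GCAs only, because of the negative iterates. *)
Definition expansive (R : realType) (gT : finGroupType)
    (F : config gT -> config gT) : Prop :=
  exists2 e : R, (0 < e)%R &
    forall c c' : config gT, c <> c' ->
      exists n : int, (e < cdist R (iterz F n c) (iterz F n c'))%R.

Definition fully_invariant (gT : finGroupType) (H : {group gT}) : Prop :=
  forall phi : {morphism [set: gT]%G >-> gT}, phi @* H \subset H.

Definition invariantly_simple (gT : finGroupType) : Prop :=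
  forall H : {group gT}, fully_invariant H -> H :=: 1 \/ H :=: [set: gT]%G.

(* [restrict_map] and [quotient_map] are only meaningful when F maps H^Z into
   itself, which holds for a GCA F and a fully invariant H. *)
Definition restrict_map (gT : finGroupType) (H : {group gT})
    (F : config gT -> config gT) : config (subg_of H) -> config (subg_of H) :=
  fun c i => subg H (F (fun j => sgval (c j)) i).

(* The elements of [coset_of H] are the cosets of H in its normaliser; for a
   normal H this type is the whole quotient group. *)
Definition quotient_map (gT : finGroupType) (H : {group gT})
    (F : config gT -> config gT) : config (coset_of H) -> config (coset_of H) :=
  fun c i => coset H (F (fun j => repr (c j)) i).

Lemma restrict_mapE (gT : finGroupType) (H : {group gT})
    (F : config gT -> config gT) :
  (forall c, (forall i, c i \in H) -> forall i, F c i \in H) ->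
  forall c : config (subg_of H),
    (fun i => sgval (restrict_map F c i)) = F (fun i => sgval (c i)).
Proof.
move=> FH c; apply/funext => i.
by rewrite subgK //; apply: FH => j; apply: subgP.
Qed.

Lemma quotient_mapE (gT : finGroupType) (H : {group gT})
    (F : config gT -> config gT) :
  normal H [set: gT]%G -> {morph F : c c' / mulc c c'} ->
  (forall c, (forall i, c i \in H) -> forall i, F c i \in H) ->
  forall c : config gT,
    quotient_map F (fun i => coset H (c i)) = fun i => coset H (F c i).
Proof.
move=> /andP[_ nH] Fm FH c; apply/funext => i.
have NH x : x \in 'N(H) by apply: (fintype.subsetP nH); rewrite finset.in_setT.
rewrite /quotient_map; set r := fun j => repr (coset H (c j)).
pose h : config gT := fun j => (r j * (c j)^-1)%g.
have hH j : h j \in H.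
  by rewrite -mem_rcoset -(val_coset (NH (c j))); apply: mem_repr_coset.
have -> : r = mulc h c by apply/funext => j; rewrite /mulc mulgKV.
by rewrite Fm /mulc morphM ?NH //= coset_id ?mul1g //; apply: FH.
Qed.

Record gca_pair := GcaPair {
  pair_group : finGroupType;
  pair_map : config pair_group -> config pair_group
}.
Arguments pair_map : clear implicits.

(* [decomposition p D]: D is the output of some run of the recursive procedure
   on p.  Outputs are predicates rather than [set gca_pair], the latter being
   universe inconsistent since [gca_pair] quantifies over finGroupType. *)
Inductive decomposition : gca_pair -> (gca_pair -> Prop) -> Prop :=
| decomposition_simple (gT : finGroupType) (F : config gT -> config gT) :
    invariantly_simple gT ->
    decomposition (GcaPair F) (fun q => q = GcaPair F)
| decomposition_step (gT : finGroupType) (F : config gT -> config gT)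
    (H : {group gT}) (D1 D2 : gca_pair -> Prop) :
    fully_invariant H -> H :!=: 1 -> H \proper [set: gT]%G ->
    decomposition (GcaPair (@quotient_map gT H F)) D1 ->
    decomposition (GcaPair (@restrict_map gT H F)) D2 ->
    decomposition (GcaPair F) (fun q => D1 q \/ D2 q).

(* Main.v *)
Require Import Defs.
From mathcomp Require Import all_boot all_order all_algebra all_fingroup.
From mathcomp Require Import all_classical all_reals all_analysis.
From mathcomp Require Import zify.

(* A GCA is a group endomorphism with a finite radius, so a bijective GCA is
   expansive iff, for some N, only the trivial configuration has all its
   iterates trivial on [-N, N].  With this criterion, expansivity of F clearly
   follows from that of its quotient and of its restriction, and passes to the
   restriction.  For the quotient one must show that a configuration whose
   iterates all lie in H on a large enough window lies in H^Z.  This is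
   Kitchens' theorem that group shifts are of finite type, applied to the
   traces on [-N, N] of the orbits in H^Z: the trace of c is locally a trace
   from H^Z, hence globally one, and expansivity identifies the two
   configurations. *)

Set Implicit Arguments.
Unset Strict Implicit.
Unset Printing Implicit Defensive.

Import Order.TTheory GRing.Theory Num.Theory GroupScope.
Local Open Scope classical_set_scope.

(** * Configurations, translations and agreement on windows *)

Definition onec (gT : finGroupType) : config gT := fun=> 1.

Definition invc (gT : finGroupType) (c : config gT) : config gT :=
  fun i => (c i)^-1.

Definition transc (gT : finGroupType) (j : int) (c : config gT) : config gT :=
  fun i => c (i + j)%R.

Definition agree (gT : finGroupType) (n : nat) (x y : config gT) : Prop :=
  forall i : int, (`|i| <= n)%N -> x i = y i.

(** Quantified over all windows, so that radii simply add under composition. *)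
Definition has_radius (gT : finGroupType) (r : nat)
    (F : config gT -> config gT) : Prop :=
  forall n x y, agree (n + r) x y -> agree n (F x) (F y).

Lemma agree_le (gT : finGroupType) m n (x y : config gT) :
  (m <= n)%N -> agree n x y -> agree m x y.
Proof. by move=> mn xy i im; apply: xy; apply: leq_trans mn. Qed.

(** * Pointwise convergence and compactness *)

Lemma near_agree (gT : finGroupType) (T : Type) (E : set_system T)
    (u : T -> config gT) (c : config gT) : Filter E ->
  (forall i, \forall t \near E, u t i = c i) ->
  forall n, \forall t \near E, agree n (u t) c.
Proof.
move=> FE uc; elim=> [|n IH].
  apply: filterS (uc 0%R) => t uc0 i; rewrite leqn0 absz_eq0 => /eqP ->.
  exact: uc0.
apply: filterS3 IH (uc n.+1%:Z%R) (uc (- n.+1%:Z)%R) => t IHt u1 u2 i.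
rewrite leq_eqVlt => /orP[/eqP in1|]; last by rewrite ltnS => /IHt.
by have [->|->] : i = n.+1%:Z%R \/ i = (- n.+1%:Z)%R by lia.
Qed.

Lemma cvg_configP (gT : finGroupType) (T : Type) (E : set_system T)
    (u : T -> config gT) (x : config gT) : Filter E ->
  (u @ E --> (x : {ptws int -> discrete_topology gT})) <->
  (forall i, \forall t \near E, u t i = x i).
Proof.
move=> FE; split=> [ux i|ux].
  have pc := @proj_continuous int (fun=> discrete_topology gT) i x.
  by have /(_ [set x i]) := cvg_comp u _ ux pc; apply; exact: discrete_set1.
apply/cvg_sup => i.
apply/cvg_image; first by apply/seteqP; split=> // v _; exists (fun=> v).
move=> A /= /nbhs_singleton Ax.
exists (proj i @^-1` A); last first.
  by apply/seteqP; split=> [j [? + <-//]|j Aj]; exists (fun _ => j).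
by apply: filterS (ux i) => t /= utx; rewrite /proj /= utx.
Qed.

(** Compactness of $G^{\mathbb{Z}}$: an ultrafilter finer than [\oo] selects one value at each site,
    and [c] collects these values. *)
Lemma limit_config (gT : finGroupType) (u : nat -> config gT) :
  exists c : config gT, forall n m : nat, exists2 k, (m <= k)%N &
    agree n (u k) c.
Proof.
have [U [UU sU]] := ultraFilterLemma (F := \oo) _.
have lim i : exists g, \forall k \near U, u k i = g.
  (* If no value at site [i] were selected, the ultrafilter would avoid each of the finitely many
     elements of [gT], hence all of them at once. *)
  apply: contrapT => /forallNP noU.
  have : \forall k \near U, forall g, g \in enum gT -> u k i <> g.
    elim: (enum gT) => [|g s IH]; first exact: nearW.
    have [/noU//|Ug] := in_ultra_setVsetC [set k | u k i = g] UU.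
    apply: filterS2 IH Ug => k us ug g'.
    by rewrite inE => /orP[/eqP->|/us].
  by case/filter_ex => k /(_ (u k i)); rewrite mem_enum => /(_ isT).
have [c cP] := choice lim.
exists c => n m.
have Um : U [set k | (m <= k)%N] by apply: sU; exists m.
have [k [kc mk]] := filter_ex (filterI (near_agree _ cP n) Um).
by exists k.
Qed.

(** * Finite radius of group cellular automata *)

Lemma morphc1 (gT hT : finGroupType) (F : config gT -> config hT) :
  {morph F : c c' / mulc c c'} -> F (onec gT) = onec hT.
Proof.
move=> Fm; apply/funext => i; apply: (mulgI (F (onec gT) i)).
have {3}-> : onec gT = mulc (onec gT) (onec gT).
  by apply/funext => j; rewrite /mulc mulg1.
by rewrite Fm mulg1.
Qed.

Lemma morphcV (gT hT : finGroupType) (F : config gT -> config hT) :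
  {morph F : c c' / mulc c c'} -> forall c, F (invc c) = invc (F c).
Proof.
move=> Fm c; apply/funext => i; apply: (mulgI (F c i)).
have := congr1 (@^~ i) (Fm c (invc c)); rewrite /= /mulc /invc mulgV => <-.
rewrite -[RHS]/(onec hT i) -(morphc1 Fm); congr (F _ i).
by apply/funext => j; rewrite mulgV.
Qed.

Lemma shiftc_transc (gT hT : finGroupType) (F : config gT -> config hT) :
  {morph F : c / shiftc c} -> forall j c, F (transc j c) = transc j (F c).
Proof.
move=> Fs j; elim/int_ind: j => [|n IH|n IH] c.
- have trans0 kT (d : config kT) : transc 0%R d = d.
    by apply/funext => i; rewrite /transc addr0.
  by rewrite !trans0.
- rewrite -[LHS]/(F (transc n.+1 c)).
  have -> : transc n.+1 c = shiftc (transc n c).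
    by apply/funext => i; rewrite /shiftc /transc; congr c; lia.
  rewrite Fs IH; apply/funext => i; rewrite /shiftc /transc; congr (F c); lia.
- have e : transc (- n%:Z)%R c = shiftc (transc (- n.+1%:Z)%R c).
    by apply/funext => i; rewrite /shiftc /transc; congr c; lia.
  apply/funext => i; have := congr1 (@^~ (i - 1)%R) (IH c).
  rewrite e Fs /shiftc subrK => ->; rewrite /transc; congr (F c); lia.
Qed.

(** Continuity at the trivial configuration bounds the dependence of site 0; the morphism property
    and the shift carry the bound to all pairs and all sites. *)
Lemma gca_radius (gT : finGroupType) (F : config gT -> config gT) :
  is_gca F -> exists r, has_radius r F.
Proof.
case=> Fc Fm Fs.
have [r rP] : exists r, forall x, agree r x (onec gT) -> F x 0%R = 1.
  apply: contrapT => /forallNP noF.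
  (* Counterexamples for growing [r] converge to [onec gT], while their images never become trivial
     at site 0. *)
  have /choice[u uP] r : exists x, agree r x (onec gT) /\ F x 0%R <> 1.
    by have /existsNP[x /not_implyP[]] := noF r; exists x.
  have u1 : u @ \oo --> (onec gT : {ptws int -> discrete_topology gT}).
    apply/cvg_configP => i; exists `|i|%N => // k /= ik.
    by have [+ _] := uP k; apply.
  have /cvg_configP/(_ 0%R) := cvg_comp u _ u1 (Fc (onec gT)).
  by case/filter_ex => k /=; rewrite morphc1 //; have [] := uP k.
exists r => n x y xy i i_n.
(* The quotient of [x] by [y], translated so that site [i] becomes site 0. *)
pose z := transc i (mulc (invc y) x).
have z1 : agree r z (onec gT).
  by move=> j jr; rewrite /z /transc /mulc /invc xy ?mulVg //; lia.
have := rP z z1; rewrite /z shiftc_transc // Fm morphcV //.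
rewrite /transc /mulc /invc add0r => /(congr1 (mulg (F y i))).
by rewrite mulKVg mulg1.
Qed.

Lemma radius_gca (gT : finGroupType) r (F : config gT -> config gT) :
  has_radius r F -> {morph F : c c' / mulc c c'} -> {morph F : c / shiftc c} ->
  is_gca F.
Proof.
move=> Fr Fm Fs; split; [move=> x | exact: Fm | exact: Fs].
have FE : Filter (nbhs (x : {ptws int -> discrete_topology gT})).
  exact: nbhs_filter.
apply/(cvg_configP F (F x) FE) => i.
have xx : (id : config gT -> config gT) y
    @[y --> (x : {ptws int -> discrete_topology gT})] -->
    (x : {ptws int -> discrete_topology gT}) by move=> A.
have {}xx := (cvg_configP id x FE).1 xx.
by apply: filterS (near_agree FE xx (`|i| + r)) => y /Fr; apply.
Qed.

Lemma gca_id (gT : finGroupType) : is_gca (id : config gT -> config gT).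
Proof. by apply: (@radius_gca _ 0) => // n x y; rewrite addn0. Qed.

Lemma gca_comp (gT : finGroupType) (F1 F2 : config gT -> config gT) :
  is_gca F1 -> is_gca F2 -> is_gca (F1 \o F2).
Proof.
move=> g1 g2; have [r1 R1] := gca_radius g1; have [r2 R2] := gca_radius g2.
case: g1 g2 => [_ m1 s1] [_ m2 s2].
apply: (@radius_gca _ (r1 + r2)) => [n x y||] /=.
- by rewrite addnA => /R2/R1.
- by move=> x y; rewrite /= m2 m1.
- by move=> x; rewrite /= s2 s1.
Qed.

Lemma gca_iter (gT : finGroupType) (F : config gT -> config gT) k :
  is_gca F -> is_gca (iter k F).
Proof.
by move=> gF; elim: k => [|k IH]; [exact: gca_id | exact: gca_comp gF IH].
Qed.

Lemma radius_iter (gT : finGroupType) (F : config gT -> config gT) r k :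
  has_radius r F -> has_radius (k * r) (iter k F).
Proof.
move=> Fr; elim: k => [|k IH] n x y; first by rewrite mul0n addn0.
by rewrite mulSn addnA => /IH/Fr.
Qed.

(** * Surjectivity and the inverse automaton *)

Lemma transc_mul_period (gT : finGroupType) (p : nat) (c : config gT) :
  transc p c = c -> forall k i : int, c (i + k * Posz p)%R = c i.
Proof.
move=> cp; elim/int_ind => [|k IH|k IH] i.
- by rewrite mul0r addr0.
- rewrite -[RHS]IH -[in RHS]cp /transc; congr c; lia.
- rewrite -[RHS]IH -[in LHS]cp /transc; congr c; lia.
Qed.

(* An injective GCA permutes the finitely many configurations of a given
   period, and these are dense. *)
Lemma gca_surj (gT : finGroupType) (F : config gT -> config gT) :
  is_gca F -> injective F -> forall y, exists x, F x = y.
Proof.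
move=> gF injF y; have [r Fr] := gca_radius gF; have [_ _ Fs] := gF.
have onto n : exists x, agree n (F x) y.
  (* The period is the length of the window [-n, n], so a periodic configuration can take arbitrary
     values there. *)
  pose p := n.*2.+1.
  pose fold (i : int) : 'I_p := inord `|(i %% p)%Z|.
  pose ext (w : {ffun 'I_p -> gT}) : config gT := fun i => w (fold i).
  have foldD (i : int) : fold (i + Posz p)%R = fold i.
    by rewrite /fold modzDr.
  have foldK (j : 'I_p) : fold (Posz j) = j.
    by rewrite /fold modz_small ?inord_val //; have := ltn_ord j; lia.
  have extp w : transc p (ext w) = ext w.
    by apply/funext => i; rewrite /transc /ext foldD.
  (* The action of [F] on periodic configurations, read on one period: an injective self-map of a
     finite set. *)
  pose f w := [ffun j : 'I_p => F (ext w) (Posz j)].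
  have Fext w : F (ext w) = ext (f w).
    apply/funext => i; rewrite /ext ffunE /fold inordK; last first.
      by have := ltz_pmod i (isT : (0 < Posz p)%R);
         have := modz_ge0 i (isT : Posz p != 0%R); lia.
    have per : transc p (F (ext w)) = F (ext w).
      by rewrite -(shiftc_transc Fs) extp.
    rewrite [in LHS](divz_eq i p) addrC (transc_mul_period per); congr (F _ _).
    by have := modz_ge0 i (isT : Posz p != 0%R); lia.
  have injf : injective f.
    move=> w w' ww'; have := Fext w; rewrite ww' -Fext => /injF eww'.
    by apply/ffunP => j; rewrite -(foldK j);
       exact: (congr1 (@^~ (Posz j)) eww').
  (* The window [-n, n] of [y] moved to [0, 2n]; the translation by [n] below moves it back. *)
  pose w := [ffun j : 'I_p => y (Posz j - Posz n)%R].
  exists (transc n (ext (invF injf w))).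
  rewrite (shiftc_transc Fs) Fext f_invF => i i_n.
  rewrite /transc /ext ffunE /fold modz_small ?inordK; last 2 first.
  - by rewrite /p; lia.
  - by rewrite /p; lia.
  by congr y; lia.
(* By finite radius, a limit of approximate preimages of [y] is an exact one. *)
have [u uP] := choice onto; have [c cP] := limit_config u.
exists c; apply/funext => i.
have [k ik /Fr uc] := cP (`|i| + r) `|i|%N.
by rewrite -uc // uP.
Qed.

Section Automorphism.
Variables (gT : finGroupType) (F : config gT -> config gT).
Hypotheses (gF : is_gca F) (injF : injective F).

Lemma inv_gcaK : cancel F (inv_gca F).
Proof. by move=> x; apply: pinvKV (in_setT x) => ? ? _ _ /injF. Qed.

Lemma gca_invK : cancel (inv_gca F) F.
Proof.
move=> y; have [x <-] := gca_surj gF injF y.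
by rewrite inv_gcaK.
Qed.

(** By compactness, finitely many sites of [F x] decide whether [x] is trivial at site 0: otherwise
    a limit of counterexamples would be a non-trivial element of the kernel of [F]. *)
Lemma inv_gca_gca : is_gca (inv_gca F).
Proof.
have [r Fr] := gca_radius gF; have [_ Fm Fs] := gF.
have imul : {morph inv_gca F : c c' / mulc c c'}.
  by move=> x y; apply: injF; rewrite Fm !gca_invK.
have ish : {morph inv_gca F : c / shiftc c}.
  by move=> x; apply: injF; rewrite Fs !gca_invK.
have [s sP] : exists s, forall x, agree s (F x) (onec gT) -> x 0%R = 1.
  apply: contrapT => /forallNP nos.
  have /choice[u uP] k : exists x, agree k (F x) (onec gT) /\ x 0%R <> 1.
    by have /existsNP[x /not_implyP[]] := nos k; exists x.
  have [c cP] := limit_config u.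
  have [k _ /(_ 0%R isT) uc0] := cP 0 0.
  have [_] := uP k; apply; rewrite uc0.
  suff -> : c = onec gT by [].
  apply: injF; rewrite morphc1 //; apply/funext => i.
  have [l il /Fr uc] := cP (`|i| + r) `|i|%N.
  by rewrite -uc //; have [+ _] := uP l; apply.
apply: (@radius_gca _ s) => // n x y xy i i_n.
pose z := inv_gca F (mulc (invc y) x).
have : transc i z 0%R = 1.
  apply: sP; rewrite (shiftc_transc Fs) gca_invK => j j_s.
  by rewrite /transc /mulc /invc xy ?mulVg //; lia.
rewrite /z imul morphcV // /transc /mulc /invc add0r.
by move=> /(congr1 (mulg (inv_gca F y i))); rewrite mulKVg mulg1.
Qed.

Lemma gca_iterz n : is_gca (iterz F n).
Proof. by case: n => k; apply: gca_iter; last exact: inv_gca_gca. Qed.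

Lemma iterzS n x : iterz F (n + 1)%R x = F (iterz F n x).
Proof.
case: n => [k|[|k]]; first by rewrite -PoszD addn1.
  by rewrite /= gca_invK.
have -> : (Negz k.+1 + 1 = Negz k)%R by lia.
by rewrite /= gca_invK.
Qed.

Lemma iterzB1 n x : iterz F (n - 1)%R x = inv_gca F (iterz F n x).
Proof. by rewrite -[n in RHS](subrK 1%R) iterzS inv_gcaK. Qed.

Lemma iterzD m n x : iterz F (m + n)%R x = iterz F m (iterz F n x).
Proof.
elim/int_ind: m => [|m IH|m IH]; first by rewrite add0r.
- have -> : (Posz m.+1 + n = Posz m + n + 1)%R by lia.
  have -> : (Posz m.+1 = Posz m + 1)%R by lia.
  by rewrite !iterzS IH.
- have -> : (- Posz m.+1 + n = - Posz m + n - 1)%R by lia.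
  have -> : (- Posz m.+1 = - Posz m - 1)%R by lia.
  by rewrite !iterzB1 IH.
Qed.

End Automorphism.

(** Lets the quotient and restriction maps commute with negative iterates too, by cancelling the
    injective [E]. *)
Lemma iterz_semiconj (gT hT : finGroupType) (F : config gT -> config gT)
    (E : config hT -> config hT) (f : config gT -> config hT) :
  is_gca F -> injective F -> is_gca E -> injective E ->
  (forall x, f (F x) = E (f x)) ->
  forall n x, f (iterz F n x) = iterz E n (f x).
Proof.
move=> gF iF gE iE fF n x; elim/int_ind: n => // n IH.
  by rewrite -addn1 PoszD !iterzS // fF IH.
rewrite -addn1 PoszD opprD !iterzB1 // -IH; apply: (iE).
by rewrite -fF !gca_invK.
Qed.

(** * Fully invariant subgroups, quotient and restriction *)

Definition configs_in (gT : finGroupType) (H : {group gT}) (c : config gT) :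
  Prop := forall i, c i \in H.

(** Conjugation by [x] is an endomorphism. *)
Lemma fully_invariant_norm (gT : finGroupType) (H : {group gT}) x :
  fully_invariant H -> x \in 'N(H).
Proof.
move=> fiH; rewrite inE; have := fiH (conjgm_morphism [set: gT]%G x).
by rewrite morphim_conj finset.setTI.
Qed.

Lemma fully_invariant_normal (gT : finGroupType) (H : {group gT}) :
  fully_invariant H -> normal H [set: gT]%G.
Proof.
move=> fiH; apply/andP; split; first exact: finset.subsetT.
by apply/fintype.subsetP => x _; exact: fully_invariant_norm.
Qed.

(* The local rule of a GCA is a product of endomorphisms of gT. *)
Lemma gca_configs_in (gT : finGroupType) (H : {group gT})
    (F : config gT -> config gT) :
  fully_invariant H -> is_gca F ->
  forall c, configs_in H c -> configs_in H (F c).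
Proof.
move=> fiH gF; have [r Fr] := gca_radius gF; have [_ Fm Fs] := gF.
pose site j (g : gT) : config gT := fun i => if i == j then g else 1.
(* The contribution of site [j] to site 0 of the image is an endomorphism of [gT]. *)
have siteF j g : g \in H -> F (site j g) 0%R \in H.
  have phiM : {in [set: gT]%G &,
      {morph (fun g => F (site j g) 0%R) : x y / x * y}}.
    move=> x y _ _; rewrite -[RHS]/(mulc _ _ 0%R) -Fm; congr (F _ _).
    by apply/funext => i; rewrite /mulc /site; case: eqP; rewrite ?mulg1.
  move=> gH; have /fintype.subsetP := fiH (Morphism phiM); apply.
  by rewrite morphimEsub ?finset.subsetT //; apply/imsetP; exists g.
have finF (s : seq int) c :
    configs_in H c -> (forall i, i \notin s -> c i = 1) -> F c 0%R \in H.
  elim: s c => [|j s IH] c cH cs.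
    have -> : c = onec gT by apply/funext => i; exact: cs.
    by rewrite morphc1 // group1.
  pose c' : config gT := fun i => if i == j then 1 else c i.
  have -> : c = mulc (site j (c j)) c'.
    apply/funext => i; rewrite /mulc /site /c'.
    by case: eqP => [->|_]; rewrite ?mulg1 ?mul1g.
  rewrite Fm groupM ?siteF // IH // => i; rewrite /c'; case: eqP => // ij js.
  by apply: cs; rewrite inE negb_or js andbT; apply/eqP.
move=> c cH i.
have -> : F c i = transc i (F c) 0%R by rewrite /transc add0r.
rewrite -(shiftc_transc Fs).
(* Truncation to [-r, r] leaves the image at site 0 unchanged and makes the support finite. *)
pose t : config gT := fun j => if (`|j| <= r)%N then transc i c j else 1.
have -> : F (transc i c) 0%R = F t 0%R.
  by apply: (Fr 0%N) => // j; rewrite /t => ->.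
apply: (finF [seq (Posz k - Posz r)%R | k <- iota 0 r.*2.+1]).
  by move=> j; rewrite /t; case: ifP => // _; exact: cH.
move=> j; rewrite /t; case: ifP => // jr /negP[].
apply/mapP; exists `|(j + Posz r)%R|%N; last by lia.
by rewrite mem_iota; lia.
Qed.

Definition coset_config (gT : finGroupType) (H : {group gT}) (c : config gT) :
    config (coset_of H) :=
  fun i => coset H (c i).

Definition sgval_config (gT : finGroupType) (H : {group gT})
    (c : config (subg_of H)) : config gT :=
  fun i => sgval (c i).

Section FullyInvariant.
Variables (gT : finGroupType) (H : {group gT}) (F : config gT -> config gT).
Hypotheses (fiH : fully_invariant H) (gF : is_gca F) (injF : injective F).

Let FH := gca_configs_in fiH gF.
Let nH := fully_invariant_normal fiH.
Let Fm : {morph F : c c' / mulc c c'}. Proof. by case: gF. Qed.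
Let Fs : {morph F : c / shiftc c}. Proof. by case: gF. Qed.

Let lift (d : config (coset_of H)) : config gT := fun i => repr (d i).
Local Notation pi := (@coset_config gT H).
Local Notation emb := (@sgval_config gT H).

Let NH x : x \in 'N(H) := fully_invariant_norm x fiH.

Let liftK d : pi (lift d) = d.
Proof. by apply/funext => i; exact: coset_reprK. Qed.

Let piM c c' : pi (mulc c c') = mulc (pi c) (pi c').
Proof.
by apply/funext => i; rewrite /coset_config /mulc morphM.
Qed.

Lemma coset_config1 c : coset_config H c = onec _ <-> configs_in H c.
Proof.
split=> [c1 i|cH].
  by apply: coset_idr => //; exact: (congr1 (@^~ i) c1).
by apply/funext => i; exact: coset_id.
Qed.

Lemma quotient_gcaE c :
  quotient_map F (coset_config H c) = coset_config H (F c).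
Proof. exact: quotient_mapE. Qed.

Lemma quotient_gca : is_gca (@quotient_map gT H F).
Proof.
have [r Fr] := gca_radius gF.
apply: (@radius_gca _ r) => [n x y xy i i_n|x y|x].
- rewrite /quotient_map; congr (coset H _).
  by apply: Fr i_n => j jn; rewrite xy.
- by rewrite -(liftK x) -(liftK y) -piM !quotient_gcaE Fm piM.
- rewrite -(liftK x) -[shiftc (pi _)]/(pi (shiftc (lift x))) !quotient_gcaE.
  by rewrite Fs.
Qed.

(** The inverse of [F] is a GCA, so it also preserves $H^{\mathbb{Z}}$; hence [F c] lies in
    $H^{\mathbb{Z}}$ only if [c] does, and the kernel is trivial. *)
Lemma quotient_gca_inj : injective (@quotient_map gT H F).
Proof.
have [_ qm _] := quotient_gca.
have ker (d : config (coset_of H)) : quotient_map F d = onec _ -> d = onec _.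
  rewrite -(liftK d) quotient_gcaE => /coset_config1 Fd.
  apply/coset_config1; rewrite -(inv_gcaK injF (lift d)).
  by apply: gca_configs_in => //; exact: inv_gca_gca.
move=> x y xy.
have : mulc (invc x) y = onec _.
  apply: ker; rewrite qm morphcV // xy.
  by apply/funext => i; exact: mulVg.
move=> e; apply/funext => i; apply: (mulgI (x i)^-1).
by rewrite mulVg -[RHS]/(mulc (invc x) y i) e.
Qed.

Lemma restrict_gcaE (c : config (subg_of H)) :
  sgval_config (restrict_map F c) = F (sgval_config c).
Proof. exact: restrict_mapE. Qed.

Let emb_inj : injective emb.
Proof.
by move=> x y xy; apply/funext => i; apply: val_inj; exact: (congr1 (@^~ i) xy).
Qed.

Lemma restrict_gca : is_gca (@restrict_map gT H F).
Proof.
have [r Fr] := gca_radius gF.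
have embM x y : emb (mulc x y) = mulc (emb x) (emb y) by [].
apply: (@radius_gca _ r) => [n x y xy i i_n|x y|x].
- rewrite /restrict_map; congr (subg H _).
  by apply: Fr i_n => j jn; rewrite xy.
- by apply: emb_inj; rewrite embM !restrict_gcaE -Fm.
- apply: emb_inj; rewrite -[emb (shiftc (restrict_map F x))]/(shiftc (emb _)).
  by rewrite !restrict_gcaE -Fs.
Qed.

Lemma restrict_gca_inj : injective (@restrict_map gT H F).
Proof.
by move=> x y xy; apply: emb_inj; apply: injF; rewrite -!restrict_gcaE xy.
Qed.

End FullyInvariant.

(** * Expansivity in terms of trivial windows *)

Definition separating (gT : finGroupType) (F : config gT -> config gT)
    (N : nat) : Prop :=
  forall c, (forall n, agree N (iterz F n c) (onec gT)) -> c = onec gT.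

(** The exponent is [N.+1] because the inequality is strict: a first difference at distance [m] is
    detected exactly when [m <= N]. *)
Lemma cdist_gt (R : realType) (gT : finGroupType) (N : nat) (c c' : config gT) :
  (2 ^- N.+1 < cdist R c c')%R <-> ~ agree N c c'.
Proof.
rewrite /cdist; case: pselect => [->|ne].
  by split=> [|[]//]; rewrite ltNge invr_ge0 exprn_ge0.
rewrite ltf_pV2 ?posrE ?exprn_gt0 // ltr_eXn2l ?ltr1n // ltnS.
case: ex_minnP => m dm minm; split=> [mN ag|nag].
  by move: dm; rewrite /differ_at !ag ?eqxx //; lia.
rewrite leqNgt; apply/negP => Nm; apply: nag => i iN.
apply/eqP; apply: contraTT (leq_ltn_trans iN Nm) => cc'.
rewrite -leqNgt; apply: minm.
rewrite /differ_at; case: i {iN} cc' => k cc'; first by rewrite absz_nat cc'.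
by rewrite /= -NegzE cc' orbT.
Qed.

(** Iterates are endomorphisms, so a pair of configurations may be replaced by its quotient and the
    trivial configuration. *)
Lemma expansiveP (R : realType) (gT : finGroupType)
    (F : config gT -> config gT) :
  is_gca F -> injective F ->
  expansive R F <-> exists N, separating F N.
Proof.
move=> gF injF; split=> [[e e0 eP]|[N sepN]].
  have [N Ne] : exists N, (2 ^- N.+1 <= e :> R)%R.
    have /archi_boundP : (0 <= e^-1)%R by rewrite invr_ge0 ltW.
    set N := Num.bound _ => eN.
    exists N; rewrite -[leRHS]invrK lef_pV2 ?posrE ?invr_gt0 ?exprn_gt0 //.
    apply: (le_trans (ltW eN)).
    by rewrite -natrX ler_nat; apply: ltnW; apply: leq_trans (ltn_expl _ _).
  exists N => c cN; apply: contrapT => /eP[n].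
  have [_ mn _] := gca_iterz gF injF n.
  rewrite (morphc1 mn) => /(le_lt_trans Ne)/cdist_gt; apply; exact: cN.
exists (2 ^- N.+1)%R; first by rewrite invr_gt0 exprn_gt0.
move=> c c' cc'; apply: contrapT => /forallNP nodist; apply: cc'.
have ag n : agree N (iterz F n c) (iterz F n c').
  by apply: contrapT => /(cdist_gt R); exact: nodist.
have : mulc (invc c) c' = onec gT.
  apply: sepN => n i iN; have [_ mn _] := gca_iterz gF injF n.
  by rewrite mn morphcV // /mulc /invc ag // mulVg.
move=> e; apply/funext => i; apply: (mulgI (c i)^-1).
by rewrite mulVg -[RHS]/(mulc (invc c) c' i) e.
Qed.

(** * Kitchens' finite type argument *)

(** Each [a] either fails at some index or holds at all of them; [M] is the maximum of the failure
    indices over the finite type. *)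
Lemma decreasing_stabilizes (T : finType) (P : nat -> T -> Prop) :
  (forall m a, P m.+1 a -> P m a) ->
  exists M, forall m a, P M a -> P m a.
Proof.
move=> Pdec.
have dec m n a : (m <= n)%N -> P n a -> P m a.
  move=> /subnKC <-; elim: (n - m)%N => [|k IH]; first by rewrite addn0.
  by rewrite addnS => /Pdec.
have /choice[f fP] a : exists Ma, forall m, P Ma a -> P m a.
  have [[m nPm]|/forallNP allP] := pselect (exists m, ~ P m a).
    by exists m.
  by exists 0%N => m _; apply: contrapT; exact: allP.
exists (\max_a f a) => m a Pa; apply: fP; apply: dec Pa.
exact: leq_bigmax.
Qed.

(* Kitchens' argument: the sets of window contents that can follow m trivial
   windows in an orbit of H^Z decrease with m, hence stabilise at some M, and
   correcting by such an orbit extends any agreement of c with H^Z on M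
   consecutive iterates by one more iterate. *)
Lemma separating_configs_in (gT : finGroupType) (F : config gT -> config gT)
    (H : {group gT}) N :
  is_gca F -> injective F -> fully_invariant H -> separating F N ->
  exists N', forall c,
    (forall n i, (`|i| <= N')%N -> iterz F n c i \in H) -> configs_in H c.
Proof.
move=> gF injF fiH sepN; have gz := gca_iterz gF injF.
have zM n : {morph iterz F n : c c' / mulc c c'} by case: (gz n).
have zH n c : configs_in H c -> configs_in H (iterz F n c).
  by apply: gca_configs_in.
have zD := iterzD gF injF.
have [r Fr] := gca_radius gF.
pose win (c : config gT) := [ffun j : 'I_N.*2.+1 => c (Posz j - Posz N)%R].
have winP x y : win x = win y -> agree N x y.
  move=> /ffunP xy i iN.
  have jlt : (`|(i + Posz N)%R| < N.*2.+1)%N by lia.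
  have := xy (Ordinal jlt); rewrite !ffunE /=.
  by have -> : (Posz `|(i + Posz N)%R|%N - Posz N = i)%R by lia.
pose follow m a := exists u, [/\ configs_in H u, win u = a &
  forall t : nat, (0 < t <= m)%N -> agree N (iterz F (- Posz t)%R u) (onec gT)].
have [M MP] : exists M, forall m a, follow M a -> follow m a.
  apply: decreasing_stabilizes => m a [u [uH ua u1]]; exists u; split=> // t.
  by case/andP=> t0 tm; apply: u1; rewrite t0 ltnW.
(* Agreement on this window still gives agreement on [-N, N] after up to [M] iterates of radius
   [r]. *)
exists (N + M * r)%N => c cH.
have ext k (n : int) : exists2 h, configs_in H h &
    forall t : nat, (t <= M + k)%N ->
      agree N (iterz F (Posz t) h) (iterz F (Posz t + n)%R c).
  elim: k n => [|k IH] n.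
    (* Truncating an iterate of [c], whose entries lie in [H] on the large window, gives an element
       of $H^{\mathbb{Z}}$. *)
    pose h : config gT := fun i =>
      if (`|i| <= N + M * r)%N then iterz F n c i else 1.
    exists h => [i|t tM].
      by rewrite /h; case: ifP => [/cH//|_]; rewrite group1.
    rewrite zD; apply: (radius_iter (k := t) Fr).
    have : agree (N + M * r) h (iterz F n c) by move=> i; rewrite /h => ->.
    by apply: agree_le; rewrite leq_add2l leq_mul2r; apply/orP; right; lia.
  (* [h] traces [c] at times 0 to M+k and [g] at times 1 to M+k+1, so their quotient [u] has trivial
     windows at times 1 to M+k. *)
  have [h hH hc] := IH n; have [h' h'H h'c] := IH (n + 1)%R.
  pose g := iterz F (-1)%R h'.
  have gc (t : nat) : (t <= M + k)%N ->
      agree N (iterz F (Posz t.+1) g) (iterz F (Posz t.+1 + n)%R c).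
    move=> /h'c; rewrite /g -zD.
    have -> : (Posz t.+1 + -1 = Posz t)%R by lia.
    by have -> : (Posz t + (n + 1) = Posz t.+1 + n)%R by lia.
  pose u := mulc (invc h) g.
  have uE n' : iterz F n' u = mulc (invc (iterz F n' h)) (iterz F n' g).
    by rewrite zM morphcV.
  have uH : configs_in H u.
    by move=> i; rewrite groupM ?groupV //; exact: zH.
  have u1 (t : nat) : (0 < t <= M + k)%N ->
      agree N (iterz F (Posz t) u) (onec gT).
    case: t => [//|t] tk i iN; rewrite uE /mulc /invc hc // gc //; last by lia.
    exact: mulVg.
  pose s : int := Posz (M + k).+1.
  have : follow (M + k)%N (win (iterz F s u)).
    exists (iterz F s u); split=> [|//|t /andP[t0 tm]]; first exact: zH.
    rewrite -zD.
    have -> : (- Posz t + s = Posz (M + k - t).+1)%R by rewrite /s; lia.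
    by apply: u1; lia.
  move=> [v0 [v0H v0u v01]].
  (* By stabilisation the window of [u] at time [s] can also follow one more trivial window. The
     resulting correction [w] leaves [h] unchanged on the window at times 0 to M+k and turns it into
     [g] at time [s]. *)
  have /MP-/(_ (M + k).+1) : follow M (win (iterz F s u)).
    by exists v0; split=> // t /andP[t0 tM]; apply: v01; rewrite t0; lia.
  move=> [v [vH /winP vu v1]].
  pose w := iterz F (- s)%R v.
  exists (mulc h w) => [i|t]; first by rewrite groupM //; exact: zH.
  rewrite addnS leq_eqVlt => /orP[/eqP->|tm] i iN; rewrite zM /mulc.
    rewrite /w -zD -/s subrr /= vu // uE /mulc /invc mulKVg.
    by rewrite /s gc.
  rewrite /w -zD hc //.
  have -> : (Posz t - s = - Posz ((M + k).+1 - t))%R by rewrite /s; lia.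
  rewrite v1 //; first exact: mulg1.
  by lia.
have diag (k : nat) : exists h, configs_in H h /\
    forall n : int, (`|n| <= k)%N -> agree N (iterz F n h) (iterz F n c).
  (* Trace [c] from time -k for 2k steps, then recentre time at 0. *)
  have [h hH hc] := ext k.*2 (- Posz k)%R.
  exists (iterz F (Posz k) h); split; first exact: zH.
  move=> n nk; rewrite -zD.
  have -> : (n + Posz k = Posz `|(n + Posz k)%R|%N)%R by lia.
  have := hc `|(n + Posz k)%R|%N.
  have -> : (Posz `|(n + Posz k)%R|%N + - Posz k = n)%R by lia.
  by apply; lia.
have [u uP] := choice diag.
(* The limit stays in $H^{\mathbb{Z}}$ and has the same windows as [c] at all times, so separation
   identifies the two. *)
have [d dP] := limit_config u.
have dH : configs_in H d.
  move=> i; have [k _ <- //] := dP `|i|%N 0%N.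
  by have [+ _] := uP k; apply.
suff -> : c = d by [].
have : mulc (invc d) c = onec gT.
  apply: sepN => n i iN; rewrite zM morphcV // /mulc /invc.
  have [rn Fn] := gca_radius (gz n).
  have [k nk /Fn ud] := dP (N + rn)%N `|n|%N.
  have [_ /(_ n nk i iN) <-] := uP k.
  by rewrite ud // mulVg.
move=> e; apply/funext => i; apply: (mulgI (d i)^-1).
by rewrite mulVg -[LHS]/(mulc (invc d) c i) e.
Qed.

(** * Expansivity along the decomposition *)

Lemma expansive_quotient_restrict (R : realType) (gT : finGroupType)
    (H : {group gT}) (F : config gT -> config gT) :
  fully_invariant H -> is_gca F -> injective F ->
  expansive R F <->
  expansive R (@quotient_map gT H F) /\ expansive R (@restrict_map gT H F).
Proof.
move=> fiH gF injF.
have gQ := quotient_gca fiH gF; have injQ := quotient_gca_inj fiH gF injF.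
have gS := restrict_gca fiH gF; have injS := restrict_gca_inj fiH gF injF.
pose pi := @coset_config gT H; pose emb := @sgval_config gT H.
have piz n c : pi (iterz F n c) = iterz (quotient_map F) n (pi c).
  apply: iterz_semiconj => // x; apply: esym; exact: quotient_gcaE.
have embz n c : emb (iterz (restrict_map F) n c) = iterz F n (emb c).
  by apply: iterz_semiconj => // x; exact: restrict_gcaE.
rewrite !expansiveP //; split=> [[N sepN]|[[N1 sepQ] [N2 sepS]]].
  split.
    have [N' N'P] := separating_configs_in gF injF fiH sepN.
    exists N' => d dN.
    pose c : config gT := fun i => repr (d i).
    have dE : pi c = d by apply/funext => i; exact: coset_reprK.
    rewrite -dE; apply/(coset_config1 fiH); apply: N'P => n j jN.
    apply: coset_idr; first exact: fully_invariant_norm.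
    by rewrite -[LHS]/(pi _ j) piz dE; exact: dN.
  exists N => c cN; apply/funext => i; apply: val_inj.
  rewrite -[LHS]/(emb c i) (sepN (emb c)) // => n j jN.
  by rewrite -embz /emb /sgval_config cN.
(* The window serves both factors: the quotient first forces [c] into $H^{\mathbb{Z}}$, then the
   restriction forces it to be trivial. *)
exists (maxn N1 N2) => c cN.
have pic : pi c = onec _.
  apply: sepQ => n i iN; rewrite -piz /pi /coset_config cN ?leq_max ?iN // .
  exact: morph1.
have cH := (coset_config1 fiH c).1 pic.
have cE : emb (fun i => subg H (c i)) = c.
  by apply/funext => i; rewrite /emb /sgval_config subgK.
rewrite -cE (sepS (fun i => subg H (c i))) // => n i iN; apply: val_inj.
rewrite -[LHS]/(emb _ i) embz cE cN // leq_max iN orbT //.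
Qed.

(** Induction on the run; being an injective GCA is carried along, since each splitting requires
    it. *)
Lemma decomposition_expansive (R : realType) (p : gca_pair)
    (D : gca_pair -> Prop) :
  decomposition p D -> is_gca (pair_map p) -> injective (pair_map p) ->
  (forall q, D q -> is_gca (pair_map q) /\ injective (pair_map q)) /\
  (expansive R (pair_map p) <-> forall q, D q -> expansive R (pair_map q)).
Proof.
elim=> {p D} [gT F _|gT F H D1 D2 fiH _ _ _ IH1 _ IH2] /= gF injF.
  by split=> [q ->|] //; split=> [eF q ->|/(_ _ erefl)].
have [g1 e1] := IH1 (quotient_gca fiH gF) (quotient_gca_inj fiH gF injF).
have [g2 e2] := IH2 (restrict_gca fiH gF) (restrict_gca_inj fiH gF injF).
split=> [q [/g1|/g2]//|].
rewrite (expansive_quotient_restrict R fiH) //.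
split=> [[/e1 E1 /e2 E2] q [/E1|/E2]//|E].
by split; [apply/e1 | apply/e2] => q Dq; apply: E; [left | right].
Qed.

Theorem theorem4 (R : realType) (gT : finGroupType)
    (F : config gT -> config gT) (D : gca_pair -> Prop)
    (F_gca : is_gca F) (F_inj : injective F)
    (FD : decomposition (GcaPair F) D) :
  (forall p : gca_pair, D p ->
     is_gca (pair_map p) /\ injective (pair_map p)) /\
  (expansive R F <->
     forall p : gca_pair, D p -> expansive R (pair_map p)).
Proof. exact: (decomposition_expansive R FD). Qed.
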